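(* Let $d\ge 1$ and let $X,X_1,X_2,\ldots$ be independent, identically distributed random vectors in $\mathbb{R}^d$ whose common distribution $\mu$ has a density $f$ with respect to Lebesgue measure (no further restriction on $f$ is imposed). Let $n\ge 1$ be an integer and let $N$ be a random variable independent of $X_1,X_2,\ldots$ having a Poisson distribution with $\mathbb{E}(N)=n$. Put $$\widetilde R_{i,n}:=\min_{j\ne i,\ 1\le j\le N}\|X_i-X_j\|\quad(1\le i\le N),\qquad \widetilde P_n:=\max_{1\le i\le N}\mu\big(S(X_i,\widetilde R_{i,n})\big).$$ Then for every $y\in\mathbb{R}$, $$\mathbb{P}\left(n\widetilde P_n-\ln n\ge y\right)\le \mathrm{e}^{-y}\exp\left(\frac{(y+\ln n)^2}{n}\right).$$
   Context: $\|\cdot\|$ is the Euclidean norm on $\mathbb{R}^d$; $S(x,r):=\{y\in\mathbb{R}^d:\|y-x\|\le r\}$ is the closed ball with center $x$ and radius $r$. Conventions for degenerate sample sizes: if $N=0$ then $\widetilde P_n:=0$; if $N=1$ then $\widetilde R_{1,n}:=\infty$, $S(X_1,\infty):=\mathbb{R}^d$, and so $\widetilde P_n=1$. *)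

(* Defs.v *)
From HB Require Import structures.
From mathcomp Require Import all_boot all_order all_algebra finmap.
From mathcomp Require Import all_classical all_reals all_analysis.
Import Order.TTheory GRing.Theory Num.Theory.
Import numFieldNormedType.Exports.

Set Implicit Arguments.
Unset Strict Implicit.
Unset Printing Implicit Defensive.

Local Open Scope classical_set_scope.
Local Open Scope ring_scope.

(* Points of R^d are [d.-tuple R]: unlike ['rV[R]_d], this type carries a
   sigma-algebra in the library, generated by the coordinate projections, i.e.
   the Borel sigma-algebra of R^d.  It has no subtraction of its own. *)
Definition tuple_sub (R : realType) (d : nat) (x y : d.-tuple R) : d.-tuple R :=
  [tuple tnth x i - tnth y i | i < d].

Definition enorm (R : realType) (d : nat) (x : d.-tuple R) : R :=
  Num.sqrt (\sum_(i < d) tnth x i ^+ 2).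

(* The radius may be +oo, in which case the ball is the whole space. *)
Definition eball (R : realType) (d : nat) (x : d.-tuple R) (r : \bar R) :
    set (d.-tuple R) :=
  [set y | ((enorm (tuple_sub y x))%:E <= r)%E].

(* Lebesgue measure on R^d: the product measure is transported along the
   identification (x, t) |-> x :: t of R * R^d with R^(d+1). *)
Definition tcons (R : realType) (d : nat) (p : measurableTypeR R * d.-tuple R) :
    d.+1.-tuple R :=
  [tuple of p.1 :: p.2].

Fixpoint lebesgue_tuple (R : realType) (d : nat) : set (d.-tuple R) -> \bar R :=
  match d with
  | 0 => \d_([tuple] : 0.-tuple R)
  | d'.+1 => pushforward (lebesgue_measure \x @lebesgue_tuple R d')%E
                         (@tcons R d')
  end.

Lemma measurable_tcons (R : realType) (d : nat) :
  measurable_fun [set: measurableTypeR R * d.-tuple R] (@tcons R d).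
Proof. by apply: measurable_cons; [exact: measurable_fst|exact: measurable_snd]. Qed.

Section lebesgue_tuple_measure.
Context (R : realType).
Local Open Scope ereal_scope.

Section step.
Variables (d : nat) (m : {sigma_finite_measure set (d.-tuple R) -> \bar R}).

Definition lebesgue_tupleS := pushforward (lebesgue_measure \x m) (@tcons R d).

Local Notation f := lebesgue_tupleS.

Let f0 : f set0 = 0.
Proof. by rewrite /lebesgue_tupleS /pushforward preimage_set0 measure0. Qed.

Let f_ge0 A : 0 <= f A.
Proof. exact: (measure_ge0 (lebesgue_measure \x m)). Qed.

Let mpre A : measurable A -> measurable (@tcons R d @^-1` A).
Proof. by move=> mA; rewrite -[X in measurable X]setTI; exact: measurable_tcons. Qed.

Let f_additive : semi_sigma_additive f.
Proof.
move=> F mF tF mUF; rewrite /lebesgue_tupleS /pushforward preimage_bigcup.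
have := @measure_semi_sigma_additive _ _ _ (lebesgue_measure \x m)
  (fun n => @tcons R d @^-1` F n).
apply.
- by move=> n; exact: mpre.
- apply/trivIsetP => /= i j _ _ ij; rewrite -preimage_setI.
  by move/trivIsetP : tF => /(_ _ _ _ _ ij) ->//; rewrite preimage_set0.
- by rewrite -preimage_bigcup; exact: mpre.
Qed.

HB.instance Definition _ := isMeasure.Build _ _ _ f f0 f_ge0 f_additive.

Let f_sigma_finite : sigma_finite [set: d.+1.-tuple R] f.
Proof.
have /sigma_finiteP[F1 [TF1 ndF1 F1oo]] := sigma_finiteT (@lebesgue_measure R).
have /sigma_finiteP[F2 [TF2 ndF2 F2oo]] := sigma_finiteT m.
pose g (t : d.+1.-tuple R) : measurableTypeR R * d.-tuple R :=
  (thead t, [tuple of behead t]).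
have gK t : tcons (g t) = t by rewrite /tcons/= -tuple_eta.
have Kg p : g (tcons p) = p.
  by case: p => x t; congr pair => //; apply/val_inj.
have mg : measurable_fun [set: d.+1.-tuple R] g.
  apply/measurable_fun_pair; last exact: measurable_behead.
  exact: measurable_tnth.
exists (fun k => g @^-1` (F1 k `*` F2 k)).
  rewrite -preimage_bigcup (_ : \bigcup_k _ = setT) ?preimage_setT//.
  rewrite -subTset => -[x t] _.
  have [k1 _ xk1] : (\bigcup_k F1 k) x by rewrite -TF1.
  have [k2 _ tk2] : (\bigcup_k F2 k) t by rewrite -TF2.
  exists (maxn k1 k2) => //; split => /=.
  - by move: xk1; exact/subsetPset/ndF1/leq_maxl.
  - by move: tk2; exact/subsetPset/ndF2/leq_maxr.
move=> k; have [mF1k F1koo] := F1oo k; have [mF2k F2koo] := F2oo k; split.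
  by rewrite -[X in measurable X]setTI; apply: mg => //; exact: measurableX.
rewrite /lebesgue_tupleS /pushforward (_ : _ @^-1` _ = F1 k `*` F2 k); last first.
  by apply/funext => p; rewrite /preimage /mkset Kg.
by rewrite product_measure1E// lte_mul_pinfty// ge0_fin_numE.
Qed.

HB.instance Definition _ :=
  Measure_isSigmaFinite.Build _ _ _ f f_sigma_finite.

Lemma lebesgue_tuple_step :
  {m' : {sigma_finite_measure set (d.+1.-tuple R) -> \bar R} |
    (m' : set _ -> \bar R) = lebesgue_tupleS}.
Proof. by exists lebesgue_tupleS. Qed.

End step.

Let lebesgue_tuple_ex d :
  {m : {sigma_finite_measure set (d.-tuple R) -> \bar R} |
    (m : set _ -> \bar R) = @lebesgue_tuple R d}.
Proof.
elim: d => [|d [m mE]].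
  by exists (\d_([tuple] : 0.-tuple R) : {sigma_finite_measure set _ -> \bar R}).
have [m' m'E] := lebesgue_tuple_step m.
by exists m'; rewrite m'E /lebesgue_tupleS mE.
Qed.

Variable d : nat.

Let lebesgue_tuple0 : @lebesgue_tuple R d set0 = 0.
Proof. by have [m <-] := lebesgue_tuple_ex d; exact: measure0. Qed.

Let lebesgue_tuple_ge0 A : 0 <= @lebesgue_tuple R d A.
Proof. by have [m <-] := lebesgue_tuple_ex d; exact: measure_ge0. Qed.

Let lebesgue_tuple_additive : semi_sigma_additive (@lebesgue_tuple R d).
Proof.
by have [m <-] := lebesgue_tuple_ex d; exact: measure_semi_sigma_additive.
Qed.

HB.instance Definition _ := isMeasure.Build _ _ _ (@lebesgue_tuple R d)
  lebesgue_tuple0 lebesgue_tuple_ge0 lebesgue_tuple_additive.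

Let lebesgue_tuple_sigma_finite :
  sigma_finite [set: d.-tuple R] (@lebesgue_tuple R d).
Proof. by have [m <-] := lebesgue_tuple_ex d; exact: sigma_finiteT. Qed.

HB.instance Definition _ := Measure_isSigmaFinite.Build _ _ _
  (@lebesgue_tuple R d) lebesgue_tuple_sigma_finite.

End lebesgue_tuple_measure.

(* The product formula on measurable rectangles characterizes this measure. *)
Lemma lebesgue_tuple_box (R : realType) (d : nat) (A : 'I_d -> set R) :
  (forall i, measurable (A i)) ->
  (lebesgue_tuple [set t : d.-tuple R | forall i, A i (tnth t i)]
   = \prod_(i < d) lebesgue_measure (A i))%E.
Proof.
elim: d A => [|d IHd] A mA.
  by rewrite big_ord0 /= diracE mem_set//= => -[].
pose B := [set t : d.-tuple R | forall i, A (lift ord0 i) (tnth t i)].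
have mB : measurable B.
  rewrite (_ : B = \bigcap_(i in [set: 'I_d])
      ((@tnth d R ^~ i) @^-1` A (lift ord0 i))); last first.
    by apply/seteqP; split => [t Bt i _|t Bt i]; [exact: Bt|exact: (Bt i I)].
  apply: fin_bigcap_measurable => // i _; rewrite -[X in measurable X]setTI.
  exact: measurable_tnth.
have mA0 : measurable (A ord0 : set (measurableTypeR R)) by exact: mA.
rewrite big_ord_recl -IHd// -/B -product_measure1E//= /pushforward.
congr (_ _); apply/seteqP; split => [[x t]/= At|[x t]/= [A0 Bt] i].
  by split => [|i]; [exact: (At ord0)|have := At (lift ord0 i); rewrite tnthS].
by case: (unliftP ord0 i) => [j ->|->//]; rewrite tnthS; exact: Bt.
Qed.

Definition has_density (R : realType) (d : nat)
    (mu : set (d.-tuple R) -> \bar R) (f : d.-tuple R -> R) : Prop :=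
  [/\ measurable_fun [set: d.-tuple R] f,
      (forall x, 0 <= f x) &
      (forall A, measurable A ->
        mu A = (\int[@lebesgue_tuple R d]_(x in A) (f x)%:E)%E)].

Section independence.
Context (dO : measure_display) (Om : measurableType dO) (R : realType)
        (P : probability Om R).
Context (d1 d2 : measure_display) (T1 : measurableType d1)
        (T2 : measurableType d2).

Definition mutually_independent (I : choiceType) (X : I -> {RV P >-> T1}) :
    Prop :=
  forall (J : {fset I}) (B : I -> set T1),
    (forall i, i \in J -> measurable (B i)) ->
    P (\bigcap_(i in [set` J]) (X i @^-1` B i))
    = (\prod_(i <- J) P (X i @^-1` B i))%E.

Definition identically_distributed (I : Type) (X : I -> {RV P >-> T1}) : Prop :=
  forall (i j : I) (B : set T1), measurable B ->
    distribution P (X i) B = distribution P (X j) B.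

Definition generated_sigma_algebra (I : Type) (X : I -> {RV P >-> T1}) :
    set (set Om) :=
  <<s \bigcup_i preimage_set_system [set: Om] (X i) measurable >>.

Definition independent_of_family (I : Type) (N : {RV P >-> T2})
    (X : I -> {RV P >-> T1}) : Prop :=
  forall (C : set T2) (E : set Om),
    measurable C -> generated_sigma_algebra X E ->
    P (N @^-1` C `&` E) = (P (N @^-1` C) * P E)%E.

End independence.

(* [poisson_pmf] takes a junk value at nonpositive rates. *)
Definition poisson_distributed (dO : measure_display) (Om : measurableType dO)
    (R : realType) (P : probability Om R) (N : {RV P >-> nat}) : Prop :=
  exists2 rate : R, 0 < rate &
    forall k : nat, P (N @^-1` [set k]) = (poisson_pmf rate k)%:E.

Section nearest_neighbor.
Context (R : realType) (d : nat).
Implicit Types (x : nat -> d.-tuple R) (N i : nat).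
Local Open Scope ereal_scope.

(* The sample is x 1, ..., x N; the minimum over the empty set is +oo, which
   covers N = 1. *)
Definition nn_dist x N i : \bar R :=
  \big[Order.min/+oo]_(1 <= j < N.+1 | j != i)
    (enorm (tuple_sub (x i) (x j)))%:E.

(* Measures being nonnegative, the initial value 0 only matters for N = 0. *)
Definition max_nn_mass (mu : set (d.-tuple R) -> \bar R) x N : \bar R :=
  \big[Order.max/0]_(1 <= i < N.+1) mu (eball (x i) (nn_dist x N i)).

End nearest_neighbor.

(* Main.v *)
Require Import Defs.
From HB Require Import structures.
From mathcomp Require Import all_boot all_order all_algebra finmap.
From mathcomp Require Import all_classical all_reals all_analysis.
From mathcomp Require Import measurable_realfun ring.
Import Order.TTheory GRing.Theory Num.Theory.
Import numFieldNormedType.Exports.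

Set Implicit Arguments.
Unset Strict Implicit.
Unset Printing Implicit Defensive.

Local Open Scope classical_set_scope.
Local Open Scope ring_scope.

(** Put [t = (y + ln n) / n]; only [0 < t <= 1] matters.  For fixed [x], the
    distance from [x] to a random point has a continuous distribution function,
    because spheres are Lebesgue null, so [mu (S(x, |x - X|))] is at least [t]
    with probability at most [1 - t].  As [r |-> mu (S(x, r))] is nondecreasing, it
    commutes with minima, and the nearest neighbour ball of [X_i] among [k]
    points has mass at least [t] iff the balls through each of the other [k - 1]
    points do.  Given [X_i] these events are independent, so the union bound over
    [i] yields [k (1 - t)^(k-1)].  Averaging over the Poisson size gives
    [sum_k e^(-n) n^k / k! * k (1 - t)^(k-1) = n e^(-n t) = e^(-y)], which is
    even smaller than the claimed bound. *)

(** * Distribution function evaluated at its own variable *)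

(** Let [a] be the infimum of the points where the cdf is at least [t]. Right continuity puts [a]
    itself among them, so the event lies in [X >= a], whose probability is [1 - cdf X a] because [a]
    is not an atom. *)
Lemma le_cdf_compl (d : measure_display) (T : measurableType d) (R : realType)
    (P : probability T R) (X : {RV P >-> R}) (t : R) :
  (forall r, P (X @^-1` [set r]) = 0%E) -> 0 < t -> t <= 1 ->
  (P [set w | t%:E <= cdf X (X w)] <= (1 - t)%:E)%E.
Proof.
move=> X0 t0 t1.
have [[r0 Fr0]|Fne] := pselect (exists r, (t%:E <= cdf X r)%E); last first.
  rewrite (_ : [set _ | _] = set0) ?measure0 ?lee_fin ?subr_ge0//.
  by rewrite -subset0 => w /= tX; apply: Fne; exists (X w).
pose S := [set r | (t%:E <= cdf X r)%E]; pose a := inf S.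
have S0 : S !=set0 by exists r0.
have SB : has_lbound S.
  have : \forall r \near -oo%R, (cdf X r < t%:E)%E.
    have nt : nbhs 0%E [set z : \bar R | (z < t%:E)%E].
      apply: open_nbhs_nbhs; split; first exact: open_ereal_lt_ereal.
      by rewrite /= lte_fin.
    exact: (@cvg_cdfNy0 _ _ _ P X _ nt).
  move=> [b [_ Fb]]; exists (b - 1) => r Sr; rewrite leNgt; apply/negP => rb.
  have rb1 : r < b by rewrite (lt_trans rb)// ltrBlDr ltrDl.
  by have := Fb r rb1; rewrite ltNge Sr.
have Sa : (t%:E <= cdf X a)%E.
  apply: (cvge_to_ge (@cdf_right_continuous _ _ _ P X a)).
  near=> r.
  have [||s Ss sr] := @inf_adherent _ S (r - a).
  - by rewrite subr_gt0.
  - by split.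
  have sr' : s <= r by rewrite ltW//; rewrite -/a subrKC in sr.
  exact: (le_trans Ss (cdf_nondecreasing X sr')).
have mX (A : set R) : measurable A -> measurable (X @^-1` A).
  by move=> mA; exact: measurable_funPTI.
have sub : [set w | (t%:E <= cdf X (X w))%E] `<=` ~` (X @^-1` `]-oo, a[).
  by move=> w /= tX; rewrite in_itv/=; apply/negP; rewrite -leNgt; exact: ge_inf.
have mA : measurable (X @^-1` `]-oo, a[) by exact: mX.
apply: (le_trans (le_measure _ _ _ sub)); rewrite ?inE.
- rewrite -[X in measurable X]setTI; apply: measurable_lee => //.
  by apply: measurableT_comp => //; exact: cdf_measurable.
- exact: measurableC.
rewrite [leLHS]probability_setC// EFinB leeB//; apply: (le_trans Sa).
(* Absence of atoms is used here: []-oo, a]] and []-oo, a[] have the same mass. *)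
rewrite /cdf /distribution /pushforward -(@setUitv1 _ _ -oo%O a true)//.
rewrite preimage_setU measureU//; first 1 last.
- by rewrite -preimage_setI (_ : _ `&` _ = set0) ?preimage_set0//;
    rewrite -subset0 => z /= [] /[swap] ->; rewrite in_itv/= ltxx.
- by rewrite [X in (_ + X)%E]X0 adde0.
Unshelve. all: by end_near. Qed.

(** * Measurability of balls and nullity of spheres *)

Lemma measurable_enorm_tuple_sub (R : realType) (d : nat) (dT : measure_display)
    (T : measurableType dT) (g h : T -> d.-tuple R) :
  measurable_fun [set: T] g -> measurable_fun [set: T] h ->
  measurable_fun [set: T] (fun w => enorm (tuple_sub (g w) (h w))).
Proof.
move=> /measurable_fun_tnthP mg /measurable_fun_tnthP mh.
rewrite /enorm; apply: measurableT_comp.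
  by apply: continuous_measurable_fun => r; exact: sqrt_continuous.
under eq_fun do under eq_bigr do rewrite tnth_mktuple.
apply: measurable_sum => i; apply: measurable_funX; apply: measurable_funB.
- exact: mg.
- exact: mh.
Qed.

(** Joint measurability in centre, radius and point makes the mass of a ball, a measure of sections,
    a measurable function of centre and radius. *)
Lemma measurable_eball_pair (R : realType) (d : nat) :
  measurable [set p : (d.-tuple R * \bar R) * d.-tuple R | eball p.1.1 p.1.2 p.2].
Proof.
rewrite -[X in measurable X]setTI; apply: measurable_lee => //; last first.
  exact: measurableT_comp.
apply/measurable_EFinP; apply: measurable_enorm_tuple_sub => //.
exact: measurableT_comp.
Qed.

(** Each line parallel to the first axis meets the sphere in at most two points. Dimension 0 must be
    excluded: there the measure is a Dirac mass, and the sphere of radius 0 has mass 1. *)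
Lemma lebesgue_tuple_sphere (R : realType) (d : nat) (x : d.+1.-tuple R) (r : R) :
  lebesgue_tuple [set z | enorm (tuple_sub z x) = r] = 0%E.
Proof.
set A := [set z | _].
have mA : measurable A.
  rewrite -[A]/((fun z => enorm (tuple_sub z x)) @^-1` [set r]).
  rewrite -[X in measurable X]setTI.
  by apply: measurable_enorm_tuple_sub => //; exact: measurable_cst.
have mB : measurable (@tcons R d @^-1` A).
  by rewrite -[X in measurable X]setTI; exact: measurable_tcons.
rewrite /= /pushforward.
(* Exchange the order of integration, so that the inner measure is the one of the first
   coordinate. *)
rewrite (@product_measure_unique _ _ _ _ _ lebesgue_measure
  (@lebesgue_tuple R d) (lebesgue_measure \x^ @lebesgue_tuple R d)%E) //; last first.
  by move=> B C mB' mC; exact: product_measure2E.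
apply: integral0_eq => t _ /=.
apply: countable_lebesgue_measure0.
(* On the section, [(a - x0) ^+ 2 = q]. A negative [q] means an empty section, so inclusion in the
   two points always holds. *)
pose q := r ^+ 2 - \sum_(i < d) (tnth t i - tnth x (lift ord0 i)) ^+ 2.
pose x0 := tnth x ord0.
apply/finite_set_countable.
apply: (@sub_finite_set _ _ [set x0 + Num.sqrt q; x0 - Num.sqrt q]) => //.
move=> a; rewrite /ysection/= inE /= /enorm => ar.
have {ar} : (a - x0) ^+ 2 = q.
  rewrite /q -ar sqr_sqrtr; last by apply: sumr_ge0 => i _; exact: sqr_ge0.
  rewrite big_ord_recl tnth_mktuple tnth0.
  under [in RHS]eq_bigr do rewrite tnth_mktuple tnthS.
  by rewrite addrK.
move=> ax; have : q = Num.sqrt q ^+ 2 by rewrite sqr_sqrtr// -ax sqr_ge0.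
rewrite -{1}ax => /eqP; rewrite eqf_sqr => /orP[] /eqP aE; [left|right] => /=.
- by rewrite -aE subrKC.
- by rewrite -aE subrKC.
Qed.

(** * Star events: factorization and product bound *)

(** Rectangles generate the product sigma-algebra and are stable under intersection; finiteness lets
    the constant sequence [setT] serve as exhaustion. *)
Lemma finite_measure_prod_unique (d1 d2 : measure_display)
    (T1 : measurableType d1) (T2 : measurableType d2) (R : realType)
    (m1 m2 : {measure set (T1 * T2) -> \bar R}) :
  (m1 setT < +oo)%E ->
  (forall A B, measurable A -> measurable B -> m1 (A `*` B) = m2 (A `*` B)) ->
  forall U, measurable U -> m1 U = m2 U.
Proof.
move=> m1oo m12 U mU.
pose C : set (set (T1 * T2)) := [set C | exists A, measurable A /\
  exists B, measurable B /\ C = A `*` B].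
apply: (measure_unique C (fun=> setT)) => //.
- rewrite measurable_prod_measurableType; congr (<<s _ >>).
  apply/seteqP; split => [_ [A mA [B mB <-]]|_ [A [mA [B [mB ->]]]]].
    by exists A; split => //; exists B.
  by exists A => //; exists B.
- move=> _ _ [A [mA [B [mB ->]]]] [A' [mA' [B' [mB' ->]]]].
  rewrite -setXI; exists (A `&` A'); split; first exact: measurableI.
  by exists (B `&` B'); split => //; exact: measurableI.
- by move=> n; exists setT; split => //; exists setT; split => //; rewrite setXTT.
- by rewrite bigcup_const//; exists 0%N.
- by move=> _ [A [mA [B [mB ->]]]]; exact: m12.
Qed.

Section restricted_law.
Context (d1 d2 : measure_display) (T1 : measurableType d1)
  (T2 : measurableType d2) (R : realType) (P : probability T1 R).

(* [mg] and [mD] do not occur in the value: they let the measure instance below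
   be inferred. *)
Definition restricted_law (g : T1 -> T2) (D : set T1)
    (mg : measurable_fun [set: T1] g) (mD : measurable D) : set T2 -> \bar R :=
  fun A => P (g @^-1` A `&` D).

Variables (g : T1 -> T2) (D : set T1).
Hypotheses (mg : measurable_fun [set: T1] g) (mD : measurable D).
Let m : {measure set T2 -> \bar R}.
Proof. by unshelve refine (pushforward (mrestr P mD) g : measure _ _). Defined.

HB.instance Definition _ := isMeasure.Build _ _ _ (restricted_law mg mD)
  (measure0 m) (measure_ge0 m) (@measure_semi_sigma_additive _ _ _ m).

Let restricted_law_fin : fin_num_fun (restricted_law mg mD).
Proof.
move=> A mA; apply: fin_num_measure; apply: measurableI => //.
by rewrite -[X in measurable X]setTI; exact: mg.
Qed.

HB.instance Definition _ := Measure_isFinite.Build _ _ _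
  (restricted_law mg mD) restricted_law_fin.

End restricted_law.

Section star.
Context (dO dT : measure_display) (Om : measurableType dO)
  (T : measurableType dT) (R : realType) (P : probability Om R).
Variables (X : nat -> {RV P >-> T}) (H : set (T * T)).
Hypotheses (X_indep : mutually_independent X) (mH : measurable H).

(** A star graph with centre [i] and leaves [J]. The constraints share [X i], so they are
    independent only conditionally on it. *)
Definition star (i : nat) (J : seq nat) : set Om :=
  [set w | forall j, j \in J -> H (X i w, X j w)].

Lemma measurable_pairRV i j :
  measurable_fun [set: Om] (fun w => (X i w, X j w)).
Proof. exact: measurable_fun_pair. Qed.

Lemma measurable_star i J : measurable (star i J).
Proof.
rewrite (_ : star i J = \bigcap_(j in [set` J])
    ((fun w => (X i w, X j w)) @^-1` H)) //.
apply: fin_bigcap_measurable => // j _; rewrite -[X in measurable X]setTI.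
exact: (measurable_pairRV i j).
Qed.

Lemma star_cons i j J :
  star i (j :: J) = (fun w => (X i w, X j w)) @^-1` H `&` star i J.
Proof.
apply/seteqP; split => [w sw|w [Hj sw] k] /=.
  by split => [|k kJ]; apply: sw; rewrite inE ?eqxx ?kJ ?orbT.
by rewrite inE => /orP[/eqP ->//|]; exact: sw.
Qed.

Local Open Scope ereal_scope.

(* The spectator indices [K] drive the induction: passing from [J] to [j :: J],
   the factorization over [j] and [K] computes both sides on rectangles in
   [(X i, X j)], and these determine a finite measure on the product. *)
Lemma prob_star_factor i J (K : {fset nat}) (B : nat -> set T) A :
  uniq (i :: J) -> i \notin K -> (forall j, j \in J -> j \notin K) ->
  measurable A -> (forall k, k \in K -> measurable (B k)) ->
  P (X i @^-1` A `&` star i J `&` \bigcap_(k in [set` K]) (X k @^-1` B k)) =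
  P (X i @^-1` A `&` star i J) * \prod_(k <- K) P (X k @^-1` B k).
Proof.
have mX k (C : set T) : measurable C -> measurable (X k @^-1` C).
  by move=> mC; exact: measurable_funPTI.
elim: J K B A => [|j J IH] K B A uJ iK JK mA mB.
  have -> : star i [::] = setT by apply/seteqP; split.
  rewrite setIT.
  (* Without leaves this is plain independence, with [B] overridden by [A] at [i]. *)
  have := X_indep (J := (i |` K)%fset) (B := fun k => if k == i then A else B k).
  rewrite big_fsetU1//= eqxx => E.
  have {E} := E _; rewrite (eq_big_seq (fun k => P (X k @^-1` B k))); last first.
    by move=> k kK /=; case: eqP => // ki; rewrite -ki kK in iK.
  move=> <-; last first.
    by move=> k; rewrite in_fset1U => /orP[/eqP ->|kK]; rewrite ?eqxx//;
      case: ifP => _ //; exact: mB.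
  congr (P _); apply/seteqP; split=> [w [Aw Bw] k|w Bw] /=.
    rewrite in_fset1U; case: eqP => [->//|_ /= kK]; exact: Bw.
  split; first by have := Bw i; rewrite /= in_fset1U eqxx => /(_ isT).
  move=> k /= kK; have := Bw k; rewrite /= in_fset1U kK orbT => /(_ isT).
  by case: eqP => // ki; rewrite -ki kK in iK.
pose C := \bigcap_(k in [set` K]) (X k @^-1` B k).
have mC : measurable C.
  by apply: fin_bigcap_measurable => // k kK; apply: mX; exact: mB.
pose c := \prod_(k <- K) P (X k @^-1` B k).
have c0 : 0 <= c by apply: prode_ge0.
have cfin : c \is a fin_num.
  rewrite /c big_seq; apply: prode_fin_num => k kK; apply: fin_num_measure.
  by apply: mX; exact: mB.
have mS := measurable_star i J.
have mSC := measurableI _ _ mS mC.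
pose pr w := (X i w, X j w).
have fc0 : (0 <= fine c)%R by exact: fine_ge0.
(* Both measures describe the pair [(X i, X j)] on the star: [m1] also imposes the spectator event,
   [m2] multiplies by its probability factor [c]. *)
pose m1 := restricted_law P (measurable_pairRV i j) mSC.
pose m2 := mscale (NngNum fc0) (restricted_law P (measurable_pairRV i j) mS).
have m12 U : measurable U -> m1 U = m2 U.
  apply: finite_measure_prod_unique => [|D E mD mE].
    by rewrite -ge0_fin_numE// fin_num_measure.
  have iJ' : uniq (i :: J).
    by move: uJ; rewrite /= inE negb_or => /and3P[/andP[_ ->] _ ->].
  have jK : j \notin K by apply: JK; rewrite inE eqxx.
  have jJ k : k \in J -> k != j.
    by move=> kJ; apply: contraTneq uJ => <-; rewrite /= kJ andbF.
  have ij : i != j by move: uJ; rewrite /= inE negb_or => /andP[/andP[]].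
  (* Here [j] becomes a spectator with set [E], so the induction hypothesis on [J] applies. Taking
     [L] to be [K] evaluates [m1] on rectangles, taking it empty evaluates [m2]. *)
  have rect (L : {fset nat}) : i \notin L -> (forall k, k \in j :: J -> k \notin L) ->
      (forall k, k \in L -> measurable (B k)) ->
      P ((fun w => (X i w, X j w)) @^-1` (D `*` E) `&`
         (star i J `&` \bigcap_(k in [set` L]) (X k @^-1` B k))) =
      P (X i @^-1` D `&` star i J) *
        (P (X j @^-1` E) * \prod_(k <- L) P (X k @^-1` B k)).
    move=> iL JL mBL.
    have jL : j \notin L by apply: JL; rewrite inE eqxx.
    have := IH (j |` L)%fset (fun k => if k == j then E else B k) D iJ'.
    rewrite in_fset1U (negbTE ij) => /(_ iL).
    have JjL k : k \in J -> k \notin (j |` L)%fset.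
      by move=> kJ; rewrite in_fset1U negb_or jJ//= JL// inE kJ orbT.
    move=> /(_ JjL mD); rewrite big_fsetU1//= eqxx.
    rewrite (eq_big_seq (fun k => P (X k @^-1` B k))); last first.
      by move=> k kL /=; case: eqP => // kj; rewrite -kj kL in jL.
    move=> <-; last first.
      by move=> k; rewrite in_fset1U => /orP[/eqP ->|kL]; rewrite ?eqxx//;
        case: ifP => _ //; exact: mBL.
    congr (P _); apply/seteqP; split.
      move=> w [[Dw Ew] [sw Bw]]; split => // k /=.
      by rewrite in_fset1U; case: eqP => [->//|_ /= kL]; exact: Bw.
    move=> w [[Dw sw] Bw]; split; first split => //=.
      by have := Bw j; rewrite /= in_fset1U eqxx => /(_ isT).
    split=> // k /= kL; have := Bw k; rewrite /= in_fset1U kL orbT => /(_ isT).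
    by case: eqP => // kj; rewrite -kj kL in jL.
  have := rect fset0; rewrite !inE => /(_ isT).
  rewrite big_seq_fset0 mule1 set_fset0 bigcap_set0 setIT => rect0.
  transitivity (c * (P (X i @^-1` D `&` star i J) * P (X j @^-1` E))).
    by rewrite [LHS](rect K iK JK mB) muleA muleC.
  rewrite /m2/= /mscale/= fineK//; congr (_ * _); apply/esym.
  by apply: rect0 => k; rewrite inE.
(* This set of pairs encodes both the new leaf [j] and the constraint [A] on [X i]. *)
have mHA : measurable (H `&` (A `*` setT)).
  by apply: measurableI => //; exact: measurableX.
have := m12 _ mHA; rewrite /m1 /m2 /restricted_law /mscale /=.
rewrite fineK// muleC => E.
rewrite star_cons (_ : _ `&` _ `&` _ = pr @^-1` (H `&` (A `*` setT)) `&` (star i J `&` C)).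
  rewrite E; congr (P _ * _).
  by apply/seteqP; split => w /=; tauto.
by apply/seteqP; split => w; rewrite /C /=; tauto.
Qed.

(** Factorization with the single spectator [j] shows that, on the star over [J], the pair
    [(X i, X j)] has a product law. Integrating the sections of [H] then costs a factor [c] for each
    leaf. *)
Lemma prob_star_le i J (c : R) : (0 <= c)%R ->
  (forall j x, P (X j @^-1` xsection H x) <= c%:E) ->
  uniq (i :: J) -> P (star i J) <= (c ^+ size J)%:E.
Proof.
move=> c0 Hc; elim: J => [|j J IH] uJ.
  by rewrite expr0 probability_le1//; exact: measurable_star.
have iJ : uniq (i :: J).
  by move: uJ; rewrite /= inE negb_or => /and3P[/andP[_ ->] _ ->].
have mS := measurable_star i J.
have mXi : measurable_fun setT (X i) by [].
pose nu := restricted_law P mXi mS.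
pose m' := restricted_law P (measurable_pairRV i j) mS.
have jJ : (forall k, k \in J -> k \notin [fset j]%fset).
  by move=> k kJ; rewrite inE; apply: contraTneq uJ => <-; rewrite /= kJ andbF.
have ij : i \notin [fset j]%fset.
  by move: uJ; rewrite /= !inE negb_or => /andP[/andP[]].
have HE : (nu \x distribution P (X j)) H = m' H.
  apply: product_measure_unique => // D E mD mE.
  have := prob_star_factor (B := fun=> E) iJ ij jJ mD (fun _ _ => mE).
  rewrite big_seq_fset1 => <-; rewrite /m'/= /restricted_law; congr (P _).
  apply/seteqP; split => w /=.
    by move=> [[Dw Ew] sw]; split => // k /=; rewrite inE => /eqP ->.
  by move=> [[Dw sw] /(_ j)]; rewrite /= inE eqxx => /(_ isT).
rewrite star_cons -[leLHS]HE /product_measure1.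
apply: (@le_trans _ _ (\int[nu]_x c%:E)).
  apply: ge0_le_integral => //.
  - exact: measurable_fun_xsection.
  - by move=> x _; exact: Hc.
rewrite integral_cst// exprS EFinM lee_wpmul2l//.
by rewrite /nu/= /restricted_law preimage_setT setTI IH.
Qed.

End star.

(** * Mass of the ball through a random point *)

Lemma enorm_tuple_subC (R : realType) (d : nat) (x z : d.-tuple R) :
  enorm (tuple_sub x z) = enorm (tuple_sub z x).
Proof.
rewrite /enorm; congr Num.sqrt; apply: eq_bigr => i _.
by rewrite !tnth_mktuple -sqrrN opprB.
Qed.

Section tail.
Context (R : realType) (d : nat) (mu : probability (d.+1.-tuple R) R)
  (f : d.+1.-tuple R -> R).
Hypothesis mu_density : has_density mu f.

Lemma density_sphere (x : d.+1.-tuple R) (r : R) :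
  mu [set z | enorm (tuple_sub z x) = r] = 0%E.
Proof.
have [mf f0 fE] := mu_density.
have mS : measurable [set z | enorm (tuple_sub z x) = r].
  rewrite -[X in measurable X]/((fun z => enorm (tuple_sub z x)) @^-1` [set r]).
  rewrite -[X in measurable X]setTI.
  by apply: measurable_enorm_tuple_sub => //; exact: measurable_cst.
rewrite fE// null_set_integral//.
- by apply/measurable_EFinP; exact: measurable_funTS.
- exact: lebesgue_tuple_sphere.
Qed.

(** View the distance to [x] as a random variable on the space of points with law [mu]: its cdf is
    the mass of balls around [x], and its atoms would be spheres, which are null. *)
Lemma eball_mass_tail (x : d.+1.-tuple R) (t : R) : 0 < t -> t <= 1 ->
  (mu [set z | t%:E <= mu (eball x (enorm (tuple_sub x z))%:E)] <= (1 - t)%:E)%E.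
Proof.
move=> t0 t1.
pose Z z := enorm (tuple_sub z x).
have mZ : measurable_fun [set: d.+1.-tuple R] Z.
  by apply: measurable_enorm_tuple_sub => //; exact: measurable_cst.
pose Zm : {RV mu >-> R} := HB.pack Z (isMeasurableFun.Build _ _ _ _ Z mZ).
have := @le_cdf_compl _ _ _ mu Zm t (density_sphere x) t0 t1.
congr (mu _ <= _)%E; apply/seteqP; split => z /=;
  rewrite enorm_tuple_subC; congr (_ <= mu _)%E;
  apply/seteqP; split => u; rewrite /eball /= in_itv/= lee_fin.
Qed.

End tail.

(** * From the maximal nearest neighbour mass to conditions on pairs *)

Lemma measurable_eball (R : realType) (d : nat) (x : d.-tuple R) (r : \bar R) :
  measurable (eball x r).
Proof.
have := measurable_xsection (x, r) (@measurable_eball_pair R d).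
by congr measurable; apply/seteqP; split => z; rewrite /xsection/= inE.
Qed.

Section ball_pairs.
Context (R : realType) (d : nat) (mu : probability (d.-tuple R) R).
Local Open Scope ereal_scope.

Definition heavy_pairs (t : R) : set (d.-tuple R * d.-tuple R) :=
  [set p | t%:E <= mu (eball p.1 (enorm (tuple_sub p.1 p.2))%:E)].

Lemma measurable_heavy_pairs t : measurable (heavy_pairs t).
Proof.
rewrite -[X in measurable X]setTI; apply: measurable_lee => //.
have := measurable_fun_xsection mu (@measurable_eball_pair R d).
set g := _ \o _ => mg.
have mr : measurable_fun [set: d.-tuple R * d.-tuple R]
    (fun p => (enorm (tuple_sub p.1 p.2))%:E).
  by apply/measurable_EFinP; exact: measurable_enorm_tuple_sub.
have := measurableT_comp mg (measurable_fun_pair (@measurable_fst _ _ _ _) mr).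
apply: eq_measurable_fun => p _; rewrite /g/=; congr (mu _).
by apply/seteqP; split => z; rewrite /xsection/= inE.
Qed.

(** Nondecreasing maps commute with binary minima. The clause at [+oo] comes from the initial value
    and is all that remains for an empty minimum. *)
Lemma le_bigmin_nondecreasing (I : eqType) (s : seq I) (Q : pred I)
    (F : I -> \bar R) (G : \bar R -> \bar R) (u : \bar R) :
  {homo G : a b / a <= b} ->
  u <= G (\big[Order.min/+oo]_(j <- s | Q j) F j) <->
  u <= G +oo /\ forall j, j \in s -> Q j -> u <= G (F j).
Proof.
move=> ndG.
have Gmin a b : u <= G (Order.min a b) <-> u <= G a /\ u <= G b.
  split=> [ub|[ua ub]]; last by rewrite minElt; case: ifP.
  by split; apply: (le_trans ub); apply: ndG; rewrite ge_min lexx ?orbT.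
elim: s => [|k s IH].
  by rewrite big_nil; split => [|[]//].
rewrite big_cons; case: ifP => Qk; split.
- move=> /Gmin[uk /IH[uoo us]]; split => // j.
  by rewrite inE => /orP[/eqP ->//|]; exact: us.
- move=> [uoo us]; apply/Gmin; split; first by apply: us; rewrite ?inE ?eqxx.
  by apply/IH; split => // j js; apply: us; rewrite inE js orbT.
- move=> /IH[uoo us]; split => // j.
  by rewrite inE => /orP[/eqP ->|]; [rewrite Qk|exact: us].
- move=> [uoo us]; apply/IH; split => // j js; apply: us.
  by rewrite inE js orbT.
Qed.

Lemma max_nn_mass_le1 (x : nat -> d.-tuple R) (N : nat) :
  max_nn_mass mu x N <= 1.
Proof.
apply: bigmax_le => [|i _]; first exact: lee01.
by apply: probability_le1; apply: measurable_eball.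
Qed.

(** Both bounds on [t] handle initial values: [0 < t] keeps the 0 of the maximum from reaching [t],
    and [t <= 1] settles the ball of infinite radius, of mass 1. For [N = 1] the condition on [j] is
    vacuous. *)
Lemma le_max_nn_mass (t : R) (x : nat -> d.-tuple R) (N : nat) :
  (0 < t)%R -> (t <= 1)%R ->
  t%:E <= max_nn_mass mu x N <->
  exists2 i, i \in index_iota 1 N.+1 &
    forall j, j \in rem i (index_iota 1 N.+1) -> heavy_pairs t (x i, x j).
Proof.
move=> t0 t1.
have massE i : t%:E <= mu (eball (x i) (nn_dist x N i)) <->
    forall j, j \in rem i (index_iota 1 N.+1) -> heavy_pairs t (x i, x j).
  have ndG : {homo (fun r => mu (eball (x i) r)) : a b / a <= b}.
    move=> a b ab; apply: le_measure; rewrite ?inE; do ?by apply: measurable_eball.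
    by move=> z /le_trans; apply.
  rewrite /nn_dist.
  have := @le_bigmin_nondecreasing _ (index_iota 1 N.+1) (fun j => j != i)
    (fun j => (enorm (tuple_sub (x i) (x j)))%:E) _ t%:E ndG.
  move=> ->; split.
    move=> [_ H] j; rewrite mem_rem_uniq ?iota_uniq// !inE => /andP[ji jN].
    by apply: H.
  move=> H; split; last first.
    move=> j jN ji; apply: H.
    by rewrite mem_rem_uniq ?iota_uniq// !inE ji.
  rewrite (_ : eball _ _ = setT) ?probability_setT ?lee_fin//.
  by apply/seteqP; split => // z _; rewrite /eball/= leey.
have maxE (s : seq nat) (F : nat -> \bar R) :
    t%:E <= \big[Order.max/0]_(i <- s) F i <-> exists2 i, i \in s & t%:E <= F i.
  elim: s => [|k s IH].
    by rewrite big_nil lee_fin leNgt t0; split => // -[].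
  rewrite big_cons le_max; split.
    move=> /orP[tk|/IH[i si ti]]; first by exists k; rewrite ?inE ?eqxx.
    by exists i; rewrite // inE si orbT.
  move=> [i]; rewrite inE => /orP[/eqP -> ->//|si ti].
  by apply/orP; right; apply/IH; exists i.
apply: (iff_trans (maxE _ _)).
by split => -[i iN ti]; exists i => //; exact/massE.
Qed.

End ball_pairs.

(** * Poisson series and identification of the rate *)

(** The factor [k] cancels against the factorial and kills the term at 0; shifting the index leaves
    an exponential series. It is used with [s = 1] for the mean and with [s = 1 - t] for the
    averaged union bound. *)
Lemma poisson_pmf_sum (R : realType) (l s : R) : 0 < l -> 0 <= s ->
  (\sum_(k <oo) (poisson_pmf l k * (k%:R * s ^+ k.-1))%:E
   = (l * expR (- (l * (1 - s))))%:E)%E.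
Proof.
move=> l0 s0.
have ge0 k : (0 <= (poisson_pmf l k * (k%:R * s ^+ k.-1))%:E)%E.
  by rewrite lee_fin !mulr_ge0 ?poisson_pmf_ge0 ?exprn_ge0.
rewrite nneseries_recl// mul0r mulr0 add0e -(@nneseries_addn _ _ 1)//.
under eq_eseriesr => k _.
  rewrite addn1.
  rewrite (_ : _ * _ = (l * expR (- l)) * ((l * s) ^+ k / k`!%:R)); last first.
    rewrite /poisson_pmf l0 factS natrM exprS exprMn /=.
    have k0 : k.+1%:R != 0 :> R by rewrite pnatr_eq0.
    have f0 : k`!%:R != 0 :> R by rewrite pnatr_eq0 -lt0n fact_gt0.
    by field; rewrite f0 addrC natr1.
  rewrite EFinM; over.
rewrite /= nneseriesZl/=; last first.
  by move=> k _; rewrite lee_fin divr_ge0// exprn_ge0// mulr_ge0// ltW.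
rewrite [RHS](_ : _ = (l * expR (- l))%:E * (expR (l * s))%:E)%E; last first.
  by rewrite -EFinM -mulrA -expRD; congr (_ * expR _)%:E; ring.
congr *%E.
rewrite expRE -EFin_lim; last first.
  rewrite /pseries/=; under eq_fun do rewrite mulrC.
  exact: is_cvg_series_exp_coeff.
apply/congr_lim/funext => k/=; rewrite /pseries/= /series/= -sumEFin//.
by under eq_bigr do rewrite mulrC.
Qed.

Lemma expectation_nat (dO : measure_display) (Om : measurableType dO)
    (R : realType) (P : probability Om R) (N : {RV P >-> nat}) :
  ('E_P[fun w => (N w)%:R] = \sum_(k <oo) k%:R%:E * P (N @^-1` [set k]))%E.
Proof.
have NU : \bigcup_k (N @^-1` [set k]) = [set: Om].
  by apply/seteqP; split => // w _; exists (N w).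
have mN k : measurable (N @^-1` [set k]) by exact: measurable_funPTI.
rewrite unlock -NU ge0_integral_bigcup//.
- apply: eq_eseriesr => k _.
  rewrite (eq_integral (cst (k%:R%:E))).
    by rewrite integral_cst.
  by move=> w; rewrite inE /= => ->.
- apply/measurable_EFinP; rewrite NU.
  exact: (@measurableT_comp _ _ _ _ _ _ (fun k : nat => k%:R : R) _ N).
- exact: trivIset_preimage1.
Qed.

(** The rate in [poisson_distributed] is existential; since the mean of a Poisson law is its rate,
    the prescribed mean determines it. *)
Lemma poisson_rate (dO : measure_display) (Om : measurableType dO)
    (R : realType) (P : probability Om R) (N : {RV P >-> nat}) (m : R) :
  poisson_distributed N -> ('E_P[fun w => (N w)%:R] = m%:E)%E ->
  forall k, P (N @^-1` [set k]) = (poisson_pmf m k)%:E.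
Proof.
move=> [l l0 Nl]; rewrite expectation_nat.
rewrite (eq_eseriesr (g := fun k =>
  (poisson_pmf l k * (k%:R * 1 ^+ k.-1))%:E)); last first.
  by move=> k _; rewrite Nl -EFinM mulrC expr1n mulr1.
rewrite poisson_pmf_sum// subrr mulr0 oppr0 expR0 mulr1 => -[<-].
exact: Nl.
Qed.

(** * Samples of fixed size, then averaging over the Poisson size *)

(** Independence from [N] concerns the sigma-algebra of [X 1], [X 2], and so on, hence the positive
    indices. The measurability proof is redone with [Om] carrying only that sigma-algebra. *)
Lemma generated_star (dO dT : measure_display) (Om : measurableType dO)
    (T : measurableType dT) (R : realType) (P : probability Om R)
    (X : nat -> {RV P >-> T}) (H : set (T * T)) (i : nat) (J : seq nat) :
  measurable H -> (0 < i)%N -> all (leq 1) J ->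
  generated_sigma_algebra (fun k => X k.+1) (star X H i J).
Proof.
move=> mH i0 /allP J0.
pose G := \bigcup_k preimage_set_system [set: Om] (X k.+1) (@measurable _ T).
pose S := g_sigma_algebraType G.
have mX k : (0 < k)%N -> measurable_fun [set: S] (X k : S -> T).
  move=> k0 _ Y mY; rewrite setTI; apply: sub_sigma_algebra.
  by exists k.-1 => //; rewrite prednK//; exists Y => //; rewrite setTI.
suff : measurable (star X H i J : set S) by [].
rewrite (_ : star X H i J = \bigcap_(j in [set` J])
    ((fun w : S => (X i w, X j w)) @^-1` H)) //.
apply: fin_bigcap_measurable => // j jJ; rewrite -[X in measurable X]setTI.
by apply: measurable_fun_pair => //; apply: mX => //; exact: J0.
Qed.

Section heavy_sample.
Context (R : realType) (dO : measure_display) (Om : measurableType dO)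
  (P : probability Om R) (d : nat) (X : nat -> {RV P >-> d.+1.-tuple R})
  (f : d.+1.-tuple R -> R) (t : R).
Hypotheses (X_indep : mutually_independent X)
  (X_ident : identically_distributed X)
  (X_density : has_density (distribution P (X 0%N)) f)
  (t0 : 0 < t) (t1 : t <= 1).

Let mu := distribution P (X 0%N).
Let star_at k i :=
  star X (heavy_pairs mu t) i.+1 (rem i.+1 (index_iota 1 k.+1)).

(** A finite union of stars gives at once measurability, membership in the generated sigma-algebra
    and a union bound. *)
Definition heavy_sample k : set Om := \big[setU/set0]_(i < k) star_at k i.

Lemma heavy_sampleE k w :
  (t%:E <= max_nn_mass mu (fun i => X i w) k)%E <-> heavy_sample k w.
Proof.
rewrite /heavy_sample -bigcup_mkord.
apply: (iff_trans (le_max_nn_mass mu (fun i => X i w) k t0 t1)); split.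
  by move=> [[|i]]; rewrite mem_index_iota// => ik H; exists i.
by move=> [i /= ik H]; exists i.+1 => //; rewrite mem_index_iota.
Qed.

Lemma generated_heavy_sample k :
  generated_sigma_algebra (fun i => X i.+1) (heavy_sample k).
Proof.
pose G := \bigcup_k preimage_set_system [set: Om] (X k.+1)
  (@measurable _ (d.+1.-tuple R)).
suff : measurable (heavy_sample k : set (g_sigma_algebraType G)) by [].
apply: bigsetU_measurable => i _; apply: generated_star => //.
  exact: measurable_heavy_pairs.
by apply/allP => j /mem_rem; rewrite mem_index_iota => /andP[].
Qed.

Lemma measurable_star_at k i : measurable (star_at k i).
Proof. by apply: measurable_star; exact: measurable_heavy_pairs. Qed.

Lemma measurable_heavy_sample k : measurable (heavy_sample k).
Proof. by apply: bigsetU_measurable => i _; exact: measurable_star_at. Qed.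

(** Union bound over [k] centres; each star has [k.-1] leaves, each costing [1 - t] by the ball mass
    tail, carried from [X 0] to [X j] by equality of laws. *)
Lemma prob_heavy_sample k :
  (P (heavy_sample k) <= (k%:R * (1 - t) ^+ k.-1)%:E)%E.
Proof.
have u_iota : uniq (index_iota 1 k.+1) by exact: iota_uniq.
have t1' : 0 <= 1 - t by rewrite subr_ge0.
apply: (le_trans (Boole_inequality _ _)).
  by move=> i _; exact: measurable_star_at.
apply: (@le_trans _ _ (\sum_(i < k) ((1 - t) ^+ k.-1)%:E)%E); last first.
  by rewrite sumEFin sumr_const card_ord mulr_natl.
apply: lee_sum => i _.
have ik : i.+1 \in index_iota 1 k.+1 by rewrite mem_index_iota /= ltnS; exact: ltn_ord.
have -> : k.-1 = size (rem i.+1 (index_iota 1 k.+1)).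
  by rewrite size_rem// size_iota subn1.
apply: prob_star_le => //.
- exact: measurable_heavy_pairs.
- move=> j x; rewrite -[leLHS]/(distribution P (X j) _) (X_ident j 0%N)//.
    apply: le_trans (eball_mass_tail X_density x t0 t1); rewrite le_eqVlt.
    by apply/orP; left; apply/eqP; congr (P (_ @^-1` _)); apply/seteqP;
      split => z; rewrite /xsection/= inE.
  by apply: measurable_xsection; exact: measurable_heavy_pairs.
- by rewrite /= rem_uniq// andbT mem_rem_uniq// !inE eqxx.
Qed.

End heavy_sample.

(* X 0 is the generic vector, X 1, X 2, ... are the sample vectors. *)
Theorem theorem3 (R : realType) (dO : measure_display) (Om : measurableType dO)
    (P : probability Om R) (d : nat) (hd : (1 <= d)%N)
    (X : nat -> {RV P >-> d.-tuple R}) (f : d.-tuple R -> R)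
    (X_indep : mutually_independent X)
    (X_ident : identically_distributed X)
    (X_density : has_density (distribution P (X 0%N)) f)
    (n : nat) (hn : (1 <= n)%N) (N : {RV P >-> nat})
    (N_indep : independent_of_family N (fun i : nat => X i.+1))
    (N_poisson : poisson_distributed N)
    (N_mean : ('E_P[fun w => (N w)%:R] = n%:R%:E)%E)
    (y : R) :
  (P [set w | y%:E <=
         (n%:R)%:E * max_nn_mass (distribution P (X 0%N)) (fun i => X i w) (N w)
         - (ln n%:R)%:E]
   <= (expR (- y) * expR ((y + ln n%:R) ^+ 2 / n%:R))%:E)%E.
Proof.
case: d hd X f X_indep X_ident X_density N_indep => // d _ X f X_indep X_ident
  X_density N_indep.
have n0 : 0 < n%:R :> R by rewrite ltr0n.
pose t := (y + ln n%:R) / n%:R.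
set mu := distribution P (X 0%N).
pose M w := max_nn_mass mu (fun i => X i w) (N w).
have -> : [set w | (y%:E <= (n%:R)%:E *
      max_nn_mass mu (fun i => X i w) (N w) - (ln n%:R)%:E)%E] =
    [set w | (t%:E <= M w)%E].
  apply/funext => w; rewrite /mkset leeBrDr// -EFinD -lee_pdivrMl//.
  by rewrite -EFinM mulrC.
have ty : expR (- y) = n%:R * expR (- (n%:R * t)).
  rewrite (mulrC n%:R t) divfK ?gt_eqF// opprD expRD (expRN (ln _)).
  by rewrite lnK ?posrE// mulrCA divff ?gt_eqF// mulr1.
(* The second factor is at least 1, so it suffices to bound the probability by [expR (- y)]. *)
have e1 : (1 <= expR ((y + ln n%:R) ^+ 2 / n%:R)).
  by rewrite -expR0 ler_expR divr_ge0 ?sqr_ge0 // ltW.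
apply: (@le_trans _ _ (expR (- y))%:E); last first.
  by rewrite lee_fin ler_peMr ?expR_ge0.
(* For [t <= 0] the event is certain, but the bound [n * expR (- (n * t))] is at least 1. *)
have [t0|t0] := leP t 0.
  have -> : [set w | (t%:E <= M w)%E] = setT.
    apply/seteqP; split => // w _ /=; rewrite (@le_trans _ _ 0%E)//.
    by rewrite /M /max_nn_mass; exact: bigmax_ge_id.
  rewrite probability_setT lee_fin ty -[leLHS]mulr1 ler_pM//.
    by rewrite ler1n.
  by rewrite -expR0 ler_expR oppr_ge0 mulr_ge0_le0 // ltW.
(* A mass cannot exceed 1, so the event is empty for [t > 1]. *)
have [t1|t1] := leP t 1; last first.
  have -> : [set w | (t%:E <= M w)%E] = set0.
    rewrite -subset0 => w /=; rewrite leNgt => /negP; apply.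
    rewrite (@le_lt_trans _ _ 1%E)// ?lte_fin//; exact: max_nn_mass_le1.
  by rewrite measure0 lee_fin expR_ge0.
have -> : [set w | (t%:E <= M w)%E] =
    \bigcup_k (N @^-1` [set k] `&` heavy_sample X t k).
  apply/seteqP; split => w /=.
    by move=> tM; exists (N w) => //; split=> //; exact/heavy_sampleE.
  by move=> [k _ [/= <- tM]]; exact/heavy_sampleE.
have mN k : measurable (N @^-1` [set k]) by exact: measurable_funPTI.
have mH k := measurable_heavy_sample X t k.
rewrite measure_bigcup//; last 2 first.
- by move=> k _; exact: measurableI.
- apply/trivIsetP => i j _ _ ij; rewrite -subset0 => w [[/= wi _] [/= wj _]].
  by rewrite -wi -wj eqxx in ij.
(* Writing [t] as [1 - (1 - t)] turns the bound into the Poisson series with [s = 1 - t], compared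
   term by term with the split over the values of [N]. *)
rewrite ty -[in leRHS](subKr 1 t) -poisson_pmf_sum ?subr_ge0//.
under eq_eseriesl do rewrite in_setT.
apply: lee_nneseries => // k _.
rewrite [leLHS](N_indep [set k] _ _ (generated_heavy_sample t k))//.
rewrite (poisson_rate N_poisson N_mean) EFinM lee_wpmul2l//.
  by rewrite lee_fin poisson_pmf_ge0.
exact: (prob_heavy_sample X_indep X_ident X_density).
Qed.
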